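(* Let $G$ be a modular graph on $n$ vertices. Then $$\overline{B_3}(G)=\frac1n\left(\frac{n-2}{2}\,W(G)-2\binom{n}{3}\right).$$
   Context: All graphs are finite, simple, undirected and connected. The distance $d(u,v)$ between two vertices is the length of a shortest path connecting them. The Wiener index $W(G)=\sum d(u,v)$ is the sum of distances over all unordered pairs $\{u,v\}$ of vertices of $G$. A graph $G$ is modular if for every three vertices $x,y,z$ there exists a vertex $w$ that lies on a shortest path between every two of the vertices $x,y,z$ (i.e. on some shortest $x$–$y$ path, some shortest $y$–$z$ path and some shortest $x$–$z$ path). For $S\subseteq V(G)$, the Steiner diversity $\delta(S)$ is the minimum number of edges of a connected subgraph of $G$ whose vertex set contains $S$. A connected subgraph of $G$ whose vertex set contains $S$ and which has exactly $\delta(S)$ edges is a tree, called a Steiner tree on $S$. The vertices in $S$ are its terminal vertices; its other vertices are its non-terminal vertices. The $3$-Steiner betweenness centrality of a vertex $v\in V(G)$ is $$B_3(v)=\sum_{\substack{A\subseteq V(G)\setminus\{v\}\\ |A|=3}}\frac{\sigma_A(v)}{\sigma_A},$$ where $\sigma_A$ is the number of all Steiner trees on $A$ in $G$ and $\sigma_A(v)$ is the number of all Steiner trees on $A$ in $G$ that include $v$ as a non-terminal vertex. The average $3$-Steiner betweenness of a graph $G$ on $n$ vertices is $\overline{B_3}(G)=\frac1n\sum_{v\in V(G)}B_3(v)$. *)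

(* Defs.v *)
From mathcomp Require Import all_boot all_order all_algebra.

Set Implicit Arguments.
Unset Strict Implicit.
Unset Printing Implicit Defensive.

(* A simple graph on the vertex type T is its adjacency relation e : rel T;
   symmetry, irreflexivity and connectedness of e are hypotheses of the
   theorem, not part of the definitions below. *)
Section Graph.
Variables (T : finType) (e : rel T).
Implicit Types (u v w x y z : T) (p : seq T) (A S : {set T}).

Definition gconnected : Prop := forall x y, connect e x y.

(* The path has vertex sequence x :: p, so its length is size p. *)
Definition gpath x y p : bool :=
  [&& path e x p, last x p == y & uniq (x :: p)].

(* A path has length < #|T|, so the default value #|T| is returned only when
   there is no path from x to y. *)
Definition dist x y : nat :=
  \big[minn/#|T|]_(k < #|T| | [exists p : k.-tuple T, gpath x y p]) k.

(* enum_rank orders T, so every unordered pair is counted exactly once. *)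
Definition wiener : nat :=
  \sum_(u : T) \sum_(v : T | enum_rank u < enum_rank v) dist u v.

Definition on_geodesic w x y : Prop :=
  exists p, [/\ gpath x y p, size p = dist x y & w \in x :: p].

Definition modular : Prop :=
  forall x y z, exists w,
    [/\ on_geodesic w x y, on_geodesic w y z & on_geodesic w x z].

Definition edges : {set {set T}} :=
  [set [set uv.1; uv.2] | uv : T * T & e uv.1 uv.2].

(* H.1 is the vertex set and H.2 the edge set; the subgraph need not be
   induced. *)
Definition subgraph (H : {set T} * {set {set T}}) : bool :=
  (H.2 \subset edges) && [forall f in H.2, f \subset H.1].

Definition subgraph_connected (H : {set T} * {set {set T}}) : bool :=
  [forall x in H.1, forall y in H.1,
     connect [rel u v | [set u; v] \in H.2] x y].

Definition connects S (H : {set T} * {set {set T}}) : bool :=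
  [&& subgraph H, subgraph_connected H & S \subset H.1].

(* The default value #|edges| is the number of edges of the whole graph,
   which is itself a candidate H when the graph is connected. *)
Definition steiner_diversity S : nat :=
  \big[minn/#|edges|]_(H : {set T} * {set {set T}} | connects S H) #|H.2|.

Definition steiner_trees S : {set {set T} * {set {set T}}} :=
  [set H | connects S H & #|H.2| == steiner_diversity S].

Definition sigma A : nat := #|steiner_trees A|.

Definition sigma_at A v : nat :=
  #|[set H in steiner_trees A | v \in H.1 :\: A]|.

Local Open Scope ring_scope.

Definition B3 v : rat :=
  \sum_(A : {set T} | (A \subset [set~ v]) && (#|A| == 3%N))
     (sigma_at A v)%:R / (sigma A)%:R.

Definition average_B3 : rat := (#|T|%:R)^-1 * \sum_(v : T) B3 v.

End Graph.

(* Main.v *)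
Require Import Defs.
From mathcomp Require Import all_boot all_order all_algebra.
From mathcomp Require Import zify.

Set Implicit Arguments.
Unset Strict Implicit.
Unset Printing Implicit Defensive.

Import GRing.Theory Num.Theory.
Local Open Scope ring_scope.

(** Summing over the vertices [v] first, [\sum_v sigma_A(v) / sigma_A] is the
    average, over the Steiner trees on [A], of the number of their non-terminal
    vertices.  A Steiner tree on [A] has [delta(A)] edges, hence
    [delta(A) + 1] vertices, so for [#|A| = 3] this average is
    [delta(A) - 2] ([sum_sigma_at], [sum_B3]), and the vertex sum of [B3] is
    the sum of [delta(A) - 2] over all triples [A].

    In a modular graph [2 delta({x, y, z}) = d(x,y) + d(y,z) + d(x,z)]
    ([steiner_diversity3]).  For the upper bound, join [x], [y], [z] to a
    median [w] by geodesics: a spanning tree of the union has at most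
    [d(w,x) + d(w,y) + d(w,z)] edges, which is half the perimeter.  For the
    lower bound, which holds in any connected graph, take a path from [x] to
    [y] in a connected subgraph through [x], [y], [z], and a path from [z] cut
    off where it first meets the former.  The two have disjoint vertex sets
    apart from the meeting point, so their total length is less than the
    number of vertices of the subgraph, hence at most its number of edges; and
    by the triangle inequality twice this length is at least the perimeter.

    Finally each pair of distinct vertices lies in [n - 2] triples, so the
    perimeters of all triples add up to [n - 2] times the Wiener index
    ([sum_steiner_diversity3]).

    All comparisons of edge and vertex numbers go through
    [spanning_edges], the existence of a spanning tree, so that edges of paths
    never have to be counted: only their vertices are. *)

(** * Distances *)

Lemma bigminn_le (I : finType) (d : nat) (P : pred I) (F : I -> nat) (j : I) :
  P j -> (\big[minn/d]_(i | P i) F i <= F j)%N.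
Proof.
move=> Pj; rewrite -big_filter.
have : j \in [seq i <- index_enum I | P i] by rewrite mem_filter Pj mem_index_enum.
elim: (filter _ _) => // i s IHs; rewrite inE big_cons => /orP [/eqP <- | /IHs].
  exact: geq_minl.
exact: leq_trans (geq_minr _ _).
Qed.

Section Graph.
Local Open Scope nat_scope.
Variables (T : finType) (e : rel T).

Lemma dist_le_path x y p : path e x p -> last x p = y -> dist e x y <= size p.
Proof.
move=> ep <-; case/shortenP: ep => q eq uq /uniq_leq_size sq.
have {}sq : size q <= size p by apply: sq; case/andP: uq.
apply: leq_trans sq.
have lt_q : size q < #|T|.
  by rewrite -[(size q).+1]/(size (x :: q)) -(card_uniqP uq) max_card.
apply: (bigminn_le _ _ (j := Ordinal lt_q)).
by apply/existsP; exists (in_tuple q); rewrite /gpath /= eq eqxx.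
Qed.

Lemma dist_path x y : connect e x y ->
  exists p, [/\ path e x p, last x p = y & size p = dist e x y].
Proof.
case/connectP=> p ep lp.
have : dist e x y < #|T|.
  case/shortenP: ep lp => q eq uq _ lq.
  apply: leq_ltn_trans (dist_le_path eq (esym lq)) _.
  by rewrite -[(size q).+1]/(size (x :: q)) -(card_uniqP uq) max_card.
rewrite /dist.
apply: (big_ind (fun m => m < #|T| ->
   exists p, [/\ path e x p, last x p = y & size p = m])).
- by rewrite ltnn.
- by move=> a b IHa IHb; rewrite /minn; case: ifP.
- move=> k /existsP [q /and3P [eq /eqP lq _]] _.
  by exists q; split=> //; rewrite size_tuple.
Qed.

Lemma distC x y : symmetric e -> connect e x y -> dist e x y = dist e y x.
Proof.
move=> e_sym.
suff le u v : connect e u v -> dist e v u <= dist e u v.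
  move=> cxy; apply/eqP; rewrite eqn_leq !le //.
  by rewrite sym_connect_sym.
move=> /dist_path [p [ep lp <-]].
have <- : size (rev (belast u p)) = size p by rewrite size_rev size_belast.
apply: dist_le_path; last first.
  by rewrite -lp; case: (p) => //= a s; rewrite rev_cons last_rcons.
by rewrite -lp rev_path (eq_path (e' := e)) // => a b; exact: e_sym.
Qed.

Lemma distxx x : dist e x x = 0.
Proof. by apply/eqP; rewrite -leqn0; exact: (@dist_le_path _ _ [::]). Qed.

Lemma dist_triangle a b c :
  gconnected e -> dist e a c <= dist e a b + dist e b c.
Proof.
move=> e_conn.
have [s [es ls <-]] := dist_path (e_conn a b).
have [t [et lt <-]] := dist_path (e_conn b c).
by rewrite -size_cat; apply: dist_le_path; rewrite ?last_cat ?cat_path ls ?es.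
Qed.

Lemma on_geodesic_dist w x y :
  on_geodesic e w x y -> dist e x w + dist e w y <= dist e x y.
Proof.
case=> p [/and3P [ep /eqP lp _] <- wp].
move: ep lp; case/splitPl: p / wp => [p1 p2 lw] ep lp.
move: ep; rewrite cat_path lw => /andP [e1 e2].
rewrite size_cat leq_add //; apply: dist_le_path => //.
by rewrite -lp last_cat lw.
Qed.

(** * Spanning trees and Steiner trees *)

(** Adjacency in the graph whose edge set is [F]; it is the relation used by
    [subgraph_connected]. *)
Definition adj (F : {set {set T}}) : rel T := [rel u v | [set u; v] \in F].

Lemma adj_sym F : symmetric (adj F).
Proof. by move=> u v; rewrite /adj /= setUC. Qed.

Lemma connect_exit (r : rel T) (V : {set T}) x y : connect r x y ->
  x \in V -> y \notin V -> exists u v, [/\ u \in V, v \notin V & r u v].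
Proof.
case/connectP=> p; elim: p x => [|a p IHp] x /=.
  by move=> _ -> yV; rewrite yV.
case/andP=> rxa ep ly xV yV; case: (boolP (a \in V)) => aV.
  exact: IHp ep ly aV yV.
by exists x, a.
Qed.

Lemma set2_in_edges u v : symmetric e -> [set u; v] \in edges e -> e u v.
Proof.
move=> e_sym /imsetP [[a b]]; rewrite inE /= => eab E.
have : u \in [set a; b] by rewrite -E set21.
have : v \in [set a; b] by rewrite -E set22.
have : b \in [set u; v] by rewrite E set22.
have : a \in [set u; v] by rewrite E set21.
rewrite !in_set2 => {E}.
by do 4 (case/orP=> /eqP ?); subst; rewrite // e_sym.
Qed.

(** A nonempty connected subgraph has a spanning tree, given by its edge set
    [F]: being a tree is expressed by connectedness and the number of edges.
    It is grown from [x], one vertex and one edge at a time. *)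
Lemma spanning_edges (H : {set T} * {set {set T}}) x :
  subgraph e H -> subgraph_connected H -> x \in H.1 ->
  exists F : {set {set T}},
    [/\ F \subset H.2, subgraph_connected (H.1, F) & #|F|.+1 = #|H.1|].
Proof.
move=> /andP [_ /forall_inP HV] Hc xH.
have Hcon u v : u \in H.1 -> v \in H.1 -> connect (adj H.2) u v.
  by move=> uH vH; have /forall_inP /(_ u uH) /forall_inP /(_ v vH) := Hc.
suff grow k : 0 < k <= #|H.1| -> exists (V : {set T}) (F : {set {set T}}),
    [/\ x \in V, V \subset H.1 & #|V| = k] /\
    [/\ F \subset H.2, [forall f in F, f \subset V], #|F|.+1 = k &
      forall u, u \in V -> connect (adj F) x u].
  have /grow : 0 < #|H.1| <= #|H.1| by rewrite leqnn andbT; apply/card_gt0P; exists x.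
  case=> V [F [[_ sV cV] [sF _ cF conF]]].
  have {}sV : V = H.1 by apply/eqP; rewrite eqEcard sV cV leqnn.
  subst V; exists F; split=> //.
  apply/forall_inP => u uH; apply/forall_inP => v vH /=.
  apply: connect_trans (conF v vH).
  by rewrite (sym_connect_sym (adj_sym F)) conF.
elim: k => // k IHk /andP [_ ltk].
case: (posnP k) => [-> | k0].
  exists [set x], set0; split; split; rewrite ?inE ?eqxx ?sub1set ?cards1 ?cards0 ?sub0set //.
    by apply/forall_inP => f; rewrite inE.
  by move=> u; rewrite inE => /eqP ->.
have /IHk : 0 < k <= #|H.1| by rewrite k0 ltnW.
case=> V [F [[xV sV cV] [sF /forall_inP FV cF conF]]].
have /subsetPn [y yH yV] : ~~ (H.1 \subset V).
  by apply: contraL ltk => /subset_leq_card; rewrite cV -leqNgt.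
have [u [v [uV vV /= uvH]]] := connect_exit (Hcon _ _ xH yH) xV yV.
exists (v |: V), ([set u; v] |: F); split; split.
- by rewrite inE xV orbT.
- rewrite subUset sV andbT sub1set.
  by apply: (subsetP (HV _ uvH)); rewrite set22.
- by rewrite cardsU1 vV cV.
- by rewrite subUset sF andbT sub1set.
- apply/forall_inP => f /setU1P [-> | fF].
    by rewrite subUset !sub1set !inE uV eqxx orbT.
  exact: subset_trans (FV f fF) (subsetUr _ _).
- rewrite cardsU1 -cF; case: (boolP (_ \in F)) => // /FV.
  by rewrite subUset !sub1set (negbTE vV) andbF.
have cF' a : a \in V -> connect (adj ([set u; v] |: F)) x a.
  move=> /conF; apply: connect_sub => b c bc; apply: connect1.
  by apply/setU1P; right.
move=> a /setU1P [-> | aV]; last exact: cF'.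
apply: connect_trans (cF' u uV) (connect1 _).
by rewrite /adj /= setU11.
Qed.

Lemma steiner_diversity_le S H :
  connects e S H -> steiner_diversity e S <= #|H.2|.
Proof. exact: bigminn_le. Qed.

Lemma connects_whole S : gconnected e -> connects e S (setT, edges e).
Proof.
move=> e_conn; apply/and3P; split; last exact: subsetT.
- by apply/andP; split=> //; apply/forall_inP => f _; exact: subsetT.
- apply/forall_inP => x _; apply/forall_inP => y _ /=.
  apply: connect_sub (e_conn x y) => u v euv; apply: connect1 => /=.
  by apply/imsetP; exists (u, v); rewrite ?inE.
Qed.

(** The minimum defining the diversity is attained, the whole graph being a
    candidate. *)
Lemma sigma_gt0 S : gconnected e -> 0 < sigma e S.
Proof.
move=> e_conn.
suff [H cH eH] : exists2 H, connects e S H & #|H.2| = steiner_diversity e S.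
  by apply/card_gt0P; exists H; rewrite inE cH eH eqxx.
rewrite /steiner_diversity.
apply: (big_ind (fun m => exists2 H, connects e S H & #|H.2| = m)).
- by exists (setT, edges e); first exact: connects_whole.
- by move=> a b IHa IHb; rewrite /minn; case: ifP.
- by move=> H cH; exists H.
Qed.

(** Otherwise a spanning tree of [H] would have fewer edges than [H]. *)
Lemma steiner_tree_card S H : S != set0 ->
  H \in steiner_trees e S -> #|H.1| = (steiner_diversity e S).+1.
Proof.
case/set0Pn=> x xS; rewrite inE => /andP [cH /eqP dH].
case/and3P: (cH) => sH kH SH.
have [F [FH Fc <-]] := spanning_edges sH kH (subsetP SH x xS).
congr _.+1; apply/eqP; rewrite eqn_leq -{1}dH subset_leq_card //=.
apply: (@steiner_diversity_le _ (H.1, F)).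
apply/and3P; split=> //.
case/andP: sH => /= sE /forall_inP sV; apply/andP; split=> /=.
  exact: subset_trans FH sE.
by apply/forall_inP => f /(subsetP FH); exact: sV.
Qed.

(** * The diversity of a triple *)

(** Any path ending in [P] can be cut off at its first vertex in [P]. *)
Lemma path_hit (r : rel T) (P : {pred T}) z q :
  path r z q -> last z q \in P ->
  exists q1 q2, [/\ q = q1 ++ q2, last z q1 \in P & all (predC (mem P)) (belast z q1)].
Proof.
elim: q z => [|a q IHq] z /=; first by exists [::], [::].
case/andP=> rza ep lP; case: (boolP (z \in P)) => zP; first by exists [::], (a :: q).
have [q1 [q2 [-> l1 a1]]] := IHq _ ep lP.
by exists (a :: q1), q2; split=> //=; rewrite zP.
Qed.

(** A connected subgraph through [x], [y], [z] has at least half as many edges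
    as the perimeter of the triple, in any connected graph. *)
Lemma perimeter_le_connects (S : {set T}) H x y z : symmetric e ->
  gconnected e -> connects e S H -> x \in S -> y \in S -> z \in S ->
  dist e x y + dist e y z + dist e x z <= #|H.2|.*2.
Proof.
move=> e_sym e_conn /and3P [sH cH /subsetP SH] xS yS zS.
have Hcon u v : u \in H.1 -> v \in H.1 -> connect (adj H.2) u v.
  by move=> uH vH; have /forall_inP /(_ u uH) /forall_inP /(_ v vH) := cH.
have [F [/subset_leq_card FH _ cF]] := spanning_edges sH cH (SH _ xS).
case/andP: sH => /subsetP sE /forall_inP sV.
have adj_e u p : path (adj H.2) u p -> path e u p.
  by apply: sub_path => a b /sE; exact: set2_in_edges.
have adj_V u p : u \in H.1 -> path (adj H.2) u p -> {subset u :: p <= H.1}.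
  elim: p u => [|b p IHp] u uH /=; first by move=> _ a; rewrite inE => /eqP ->.
  case/andP=> /sV /subsetP sub ep a; rewrite inE => /orP [/eqP -> // | ].
  by apply: IHp => //; apply: sub; rewrite set22.
have /connectP [p0 ep0 lp0] := Hcon _ _ (SH _ xS) (SH _ yS).
case/shortenP: ep0 lp0 => p ep up _ lp {p0}.
have /connectP [q0 eq0 lq0] := Hcon _ _ (SH _ zS) (SH _ xS).
case/shortenP: eq0 lq0 => q eq uq _ lq {q0}.
have [|q1 [q2 [Eq l1 a1]]] := path_hit (P := mem (x :: p)) eq.
  by rewrite -lq /= inE eqxx.
have qV := adj_V _ _ (SH _ zS) eq.
move: eq uq; rewrite Eq cat_path -cat_cons cat_uniq => /andP [eq1 _] /andP [uq1 _].
(* The vertices of [x :: p], and those of [z :: q1] except the last, are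
   pairwise distinct vertices of [H]. *)
have sz : size p + size q1 < #|H.1|.
  have U : uniq ((x :: p) ++ belast z q1).
    rewrite cat_uniq up /=; apply/andP; split.
      by rewrite -all_predC.
    by move: uq1; rewrite lastI rcons_uniq => /andP [].
  rewrite -(size_belast z q1) -addSn -[(size p).+1]/(size (x :: p)) -size_cat.
  rewrite -(card_uniqP U); apply/subset_leq_card/subsetP => a.
  rewrite mem_cat => /orP [|/mem_belast]; first exact: adj_V (SH _ xS) ep a.
  by move=> aq; apply: qV; rewrite Eq -cat_cons mem_cat aq.
have lexz u s : path e u s -> dist e u (last u s) <= size s.
  by move=> es; apply: dist_le_path.
set w := last z q1 in l1.
have dzw : dist e z w <= size q1 by apply/lexz/adj_e.
have dxy : dist e x y <= size p by rewrite lp; apply/lexz/adj_e.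
have dxwy : dist e x w + dist e w y <= size p.
  move: ep lp => /adj_e {up sz dxy a1}.
  case/splitPl: p / l1 => [p1 p2 lw].
  rewrite cat_path last_cat lw => /andP [e1 e2] ->.
  by rewrite size_cat leq_add //; [rewrite -lw|]; apply: lexz.
have := dist_triangle x w z e_conn; have := dist_triangle y w z e_conn.
rewrite (distC e_sym (e_conn w z)) (distC e_sym (e_conn y w)).
lia.
Qed.

(** The witness is a spanning tree of the subgraph induced by the vertices of
    three geodesics issued from [w]. *)
Lemma star_connects x y z w : symmetric e -> gconnected e ->
  steiner_diversity e [set x; y; z] <= dist e w x + dist e w y + dist e w z.
Proof.
move=> e_sym e_conn.
have [p [ep lp <-]] := dist_path (e_conn w x).
have [q [eq lq <-]] := dist_path (e_conn w y).
have [r [er lr <-]] := dist_path (e_conn w z).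
pose V := [set a in w :: p ++ q ++ r].
pose H : {set T} * {set {set T}} := (V, [set f in edges e | f \subset V]).
have wV : w \in V by rewrite !inE eqxx.
have subV s : {subset s <= p ++ q ++ r} -> {subset s <= V}.
  by move=> sub a /sub; rewrite !inE => ->; rewrite orbT.
have pV : {subset p <= V} by apply: subV => a; rewrite !mem_cat => ->.
have qV : {subset q <= V} by apply: subV => a; rewrite !mem_cat => ->; rewrite orbT.
have rV : {subset r <= V} by apply: subV => a; rewrite !mem_cat => ->; rewrite !orbT.
have conw a s : a \in V -> path e a s -> {subset s <= V} ->
    forall b, b \in s -> connect (adj H.2) a b.
  elim: s a => // c s IHs a aV /= /andP [eac es] sub b.
  have cV : c \in V by apply: sub; rewrite mem_head.
  have cac : connect (adj H.2) a c.
    apply: connect1; rewrite /adj /= inE subUset !sub1set aV cV !andbT.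
    by apply/imsetP; exists (a, c); rewrite ?inE.
  rewrite inE => /orP [/eqP -> // | bs]; apply: connect_trans cac _.
  by apply: IHs => // d ds; apply: sub; rewrite inE ds orbT.
have conV a : a \in V -> connect (adj H.2) w a.
  rewrite !inE !mem_cat => /orP [/eqP -> // | /or3P []]; exact: conw.
have sH : subgraph e H.
  apply/andP; split; first by apply/subsetP => f; rewrite inE => /andP [].
  by apply/forall_inP => f; rewrite inE => /andP [].
have cH : subgraph_connected H.
  apply/forall_inP => a aV; apply/forall_inP => b bV.
  apply: connect_trans (conV b bV).
  by rewrite (sym_connect_sym (adj_sym H.2)) conV.
have [F [FH Fc cF]] := spanning_edges sH cH wV.
have lastV s : {subset s <= V} -> last w s \in V.
  move=> sub; have := mem_last w s; rewrite inE => /orP [/eqP -> //|]; exact: sub.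
apply: (@leq_trans #|F|).
  apply: (@steiner_diversity_le _ (V, F)); apply/and3P; split=> //=.
    case/andP: sH => /= sE /forall_inP sV; apply/andP; split=> /=.
      exact: subset_trans FH sE.
    by apply/forall_inP => f /(subsetP FH); exact: sV.
  apply/subsetP => a; rewrite !inE -orbA => /or3P [] /eqP ->.
  - by rewrite -lp; have := lastV _ pV; rewrite inE.
  - by rewrite -lq; have := lastV _ qV; rewrite inE.
  - by rewrite -lr; have := lastV _ rV; rewrite inE.
rewrite -ltnS cF /= cardsE; apply: leq_trans (card_size _) _.
by rewrite /= !size_cat addnA.
Qed.

Lemma steiner_diversity3 x y z :
  symmetric e -> gconnected e -> modular e ->
  (steiner_diversity e [set x; y; z]).*2 = dist e x y + dist e y z + dist e x z.
Proof.
move=> e_sym e_conn e_mod; apply/eqP; rewrite eqn_leq; apply/andP; split.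
  have [w [/on_geodesic_dist g1 /on_geodesic_dist g2 /on_geodesic_dist g3]] := e_mod x y z.
  have := star_connects x y z w e_sym e_conn.
  move: g1 g2 g3; rewrite (distC e_sym (e_conn x w)) (distC e_sym (e_conn y w)).
  lia.
have /card_gt0P [H] := sigma_gt0 [set x; y; z] e_conn.
rewrite inE => /andP [cH /eqP <-].
by apply: perimeter_le_connects cH _ _ _ => //; rewrite !inE eqxx ?orbT.
Qed.

(** * Summation over triples *)

(** The sum is over ordered pairs, hence twice the perimeter. *)
Lemma sum_dist_triple (A : {set T}) :
  symmetric e -> gconnected e -> modular e -> #|A| = 3 ->
  \sum_(u in A) \sum_(v in A) dist e u v = 4 * steiner_diversity e A.
Proof.
move=> e_sym e_conn e_mod cA.
have /card_gt0P [x xA] : 0 < #|A| by rewrite cA.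
have cAx : #|A :\ x| = 2 by move: cA; rewrite (cardsD1 x) xA => -[].
have /cards2P [y [z [yz EA]]] : #|A :\ x| == 2 by rewrite cAx.
have {}EA : A = [set x; y; z] by rewrite -setUA -EA setD1K.
have [xy xz] : x != y /\ x != z.
  move: cA; rewrite EA -setUA cardsU1 cards2 yz !inE negb_or.
  by case: eqP; case: eqP.
have sumA (f : T -> nat) : \sum_(u in A) f u = f x + f y + f z.
  rewrite EA -setUA big_setU1 ?big_setU1 ?big_set1 ?inE ?negb_or ?xy //= addnA //.
rewrite !sumA !distxx EA; have := steiner_diversity3 x y z e_sym e_conn e_mod.
rewrite (@distC y x) // (@distC z x) // (@distC z y) //.
lia.
Qed.

Lemma card_triples_pair (u v : T) : u != v ->
  #|[set A : {set T} | [&& #|A| == 3, u \in A & v \in A]]| = #|T| - 2.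
Proof.
move=> uv.
have <- : #|~: [set u; v]| = #|T| - 2 by rewrite cardsCs setCK cards2 uv.
rewrite -(card_in_imset (f := fun z => z |: [set u; v])); last first.
  move=> a b; rewrite !inE !negb_or => /andP [/negbTE au /negbTE av] _ /setP /(_ a).
  by rewrite !inE eqxx au av !orbF /= => /esym/eqP.
congr #|pred_of_set _|; apply/setP=> A; rewrite inE; apply/idP/imsetP.
  case/and3P=> /eqP cA uA vA.
  have sA : [set u; v] \subset A by rewrite subUset !sub1set uA vA.
  have /cards1P [z Ez] : #|A :\: [set u; v]| == 1.
    by rewrite cardsDS // cA cards2 uv.
  exists z; last by rewrite -Ez setUC -{1}(setIidPr sA) setID.
  have : z \in A :\: [set u; v] by rewrite Ez set11.
  by rewrite in_setD in_setC => /andP [].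
case=> z zuv ->; rewrite cardsU1 cards2 uv.
by move: zuv; rewrite inE => ->; rewrite !inE !eqxx !orbT.
Qed.

Lemma sum_dist_wiener : symmetric e -> gconnected e ->
  \sum_u \sum_v dist e u v = (wiener e).*2.
Proof.
move=> e_sym e_conn; rewrite -addnn {2}/wiener.
rewrite [X in _ = _ + X](exchange_big_dep xpredT) //= /wiener -big_split /=.
apply: eq_bigr => u _.
rewrite (bigID (fun v => enum_rank u < enum_rank v)) /=; congr (_ + _).
rewrite (bigD1 u) /= ?ltnn // distxx add0n; apply: eq_big => v.
  by rewrite -leqNgt ltn_neqAle andbC (inj_eq val_inj) (inj_eq enum_rank_inj).
by move=> _; apply: distC.
Qed.

Lemma sum_steiner_diversity3 :
  symmetric e -> gconnected e -> modular e ->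
  2 * \sum_(A : {set T} | #|A| == 3) steiner_diversity e A = (#|T| - 2) * wiener e.
Proof.
move=> e_sym e_conn e_mod.
(* Multiplied by two, both sides become sums over ordered pairs. *)
suff : 4 * \sum_(A : {set T} | #|A| == 3) steiner_diversity e A
       = (#|T| - 2) * (wiener e).*2 by rewrite -mul2n; lia.
rewrite -sum_dist_wiener // !big_distrr /=.
rewrite (eq_bigr (fun A : {set T} =>
    \sum_u \sum_v ((u \in A) && (v \in A)) * dist e u v)); last first.
  move=> A /eqP cA; rewrite -sum_dist_triple // big_mkcond /=; apply: eq_bigr => u _.
  case: (u \in A); last by rewrite big1.
  by rewrite big_mkcond; apply: eq_bigr => v _ /=; case: (v \in A); rewrite ?mul1n.
rewrite exchange_big; apply: eq_bigr => u _ /=.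
rewrite exchange_big big_distrr; apply: eq_bigr => v _ /=.
rewrite -big_distrl /=; have [<- | uv] := eqVneq u v; first by rewrite distxx !muln0.
rewrite -(card_triples_pair uv) -sum1_card; congr (_ * _).
rewrite [RHS](eq_bigl (fun A : {set T} => (#|A| == 3) && ((u \in A) && (v \in A)))).
  by rewrite [RHS]big_mkcondr; apply: eq_bigr => A _; case: (_ && _).
by move=> A; rewrite inE.
Qed.

(** Count the pairs of a Steiner tree and one of its non-terminal vertices. *)
Lemma sum_sigma_at A : A != set0 ->
  \sum_v sigma_at e A v = sigma e A * ((steiner_diversity e A).+1 - #|A|).
Proof.
move=> A0; rewrite /sigma -sum_nat_const.
under eq_bigr do rewrite /sigma_at -sum1_card.
rewrite (exchange_big_dep [in steiner_trees e A]) /=; last first.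
  by move=> v H _; rewrite inE => /andP [].
apply: eq_bigr => H HA.
rewrite -(steiner_tree_card A0 HA) -cardsDS; last first.
  by move: HA; rewrite inE => /andP [/and3P []].
rewrite -sum1_card; apply: eq_bigl => v.
by rewrite !inE; move: HA; rewrite inE => ->.
Qed.

Lemma card_le_steiner_diversity A :
  gconnected e -> A != set0 -> #|A| <= (steiner_diversity e A).+1.
Proof.
move=> e_conn A0; have /card_gt0P [H HA] := sigma_gt0 A e_conn.
rewrite -(steiner_tree_card A0 HA) subset_leq_card //.
by move: HA; rewrite inE => /andP [/and3P []].
Qed.

End Graph.

Lemma sum_B3 (T : finType) (e : rel T) : gconnected e ->
  \sum_v B3 e v =
  \sum_(A : {set T} | #|A| == 3%N) ((steiner_diversity e A)%:R - 2%:R).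
Proof.
move=> e_conn; rewrite /B3 (exchange_big_dep (fun A : {set T} => #|A| == 3%N)) /=.
  2: by move=> v A _ /andP [].
apply: eq_bigr => A /eqP cA.
have A0 : A != set0 by rewrite -card_gt0 cA.
rewrite -mulr_suml.
have -> : \sum_(v | (A \subset [set~ v]) && (#|A| == 3%N)) (sigma_at e A v)%:R
    = (\sum_v sigma_at e A v)%:R :> rat.
  rewrite natr_sum big_mkcond; apply: eq_bigr => v _.
  rewrite cA eqxx andbT subsetC sub1set inE.
  case: ifPn => // /negPn vA; rewrite /sigma_at -sum1_card big_pred0 // => H.
  by rewrite !inE vA andbF.
rewrite sum_sigma_at // natrM mulrAC divff ?mul1r; last first.
  by rewrite pnatr_eq0 -lt0n sigma_gt0.
have := card_le_steiner_diversity e_conn A0; rewrite cA => d3.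
by rewrite subSS natrB.
Qed.

Theorem corollary6 (T : finType) (e : rel T) (n : nat)
    (e_sym : symmetric e) (e_irr : irreflexive e) (e_conn : gconnected e)
    (e_mod : modular e) (card_T : #|T| = n) :
  average_B3 e =
    (n%:R)^-1 * ((n%:R - 2%:R) / 2%:R * (wiener e)%:R - 2%:R * ('C(n, 3))%:R).
Proof.
rewrite /average_B3 card_T sum_B3 // sumrB -natr_sum; congr (_ * (_ - _)).
  apply: (@mulfI _ 2%:R); first by [].
  rewrite -natrM sum_steiner_diversity3 // card_T natrM mulrA mulrCA divff // mulr1.
  have [n2 | n2] := leqP 2 n; first by rewrite natrB.
  (* The truncated [n - 2] differs from [n%:R - 2] only if there is at most one
     vertex, and then the Wiener index vanishes. *)
  suff -> : wiener e = 0%N by rewrite !mulr0.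
  rewrite /wiener big1 // => u _; rewrite big_pred0 // => v.
  have v1 : (enum_rank v <= 0)%N.
    by rewrite -ltnS; apply: leq_trans (ltn_ord _) _; rewrite card_T.
  by rewrite ltnNge (leq_trans v1).
rewrite sumr_const -[LHS]mulr_natr; congr (_ * _%:R).
rewrite -card_T -[RHS](card_draws T 3).
by apply: eq_card => A; rewrite inE.
Qed.
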